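(* Let $G$ be a discrete countable group, $\varphi:G\to G$ an injective endomorphism with infinite cokernel, and $B$ a set of subgroups of $G$ containing $G$. Let $S=G\rtimes_\varphi\mathbb{N}$, let $D[\varphi,B]=C^*(\{u_gs^ne_{[H]}{s^*}^nu_{g^{-1}}:g\in G,n\in\mathbb{N},H\in B\})\subseteq\mathbb{U}[\varphi,B]$, and let $\alpha:S\to\mathrm{End}(D[\varphi,B])$ be the action $\alpha_{(g,n)}(x)=u_gs^nx{s^*}^nu_{g^{-1}}$. Then the C$^*$-algebra $\mathbb{U}[\varphi,B]$ is isomorphic to the semigroup crossed product $D[\varphi,B]\rtimes_\alpha S$.
   Context: $\mathbb{N}=\{0,1,2,\dots\}$. Infinite cokernel means that the set of left cosets $G/\varphi(G)$ is infinite. $C(B)$ is the smallest collection of subsets of $G$ that contains $B$ and is closed under finite unions, finite intersections, complements in $G$, images $X\mapsto\varphi(X)$ and left translations $X\mapsto gX$ ($g\in G$). $\mathbb{U}[\varphi,B]$ is the universal C$^*$-algebra generated by projections $\{e_{[X]}:X\in C(B)\}$, unitaries $\{u_g:g\in G\}$ and one isometry $s$ subject to, for all $g,h\in G$, $n,m\in\mathbb{N}$, $X,Y\in C(B)$: (i) $u_gs^nu_hs^m=u_{g\varphi^n(h)}s^{n+m}$; (ii) $u_gs^ne_{[X]}{s^*}^nu_{g^{-1}}=e_{[g\varphi^n(X)]}$; (iii) $e_{[G]}=1$ and $e_{[\emptyset]}=0$; (iv) $e_{[X]}e_{[Y]}=e_{[X\cap Y]}$; (v) $e_{[X]}+e_{[Y]}=e_{[X\cup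 Y]}+e_{[X\cap Y]}$. $S=G\rtimes_\varphi\mathbb{N}$ is the set $G\times\mathbb{N}$ with product $(g,n)(h,m)=(g\varphi^n(h),n+m)$. For a semigroup $S$ acting by endomorphisms $\alpha$ on a unital C$^*$-algebra $D$, the semigroup crossed product $D\rtimes_\alpha S$ is the universal unital C$^*$-algebra for covariant representations: it comes with a unital $*$-homomorphism $\iota_D:D\to D\rtimes_\alpha S$ and a semigroup homomorphism $\iota_S$ from $S$ to the isometries of $D\rtimes_\alpha S$ with $\iota_S(p)\iota_D(x)\iota_S(p)^*=\iota_D(\alpha_p(x))$, it is generated by their images, and any other such pair $(\pi,\rho)$ into a unital C$^*$-algebra $A$ factors through a unique $*$-homomorphism $D\rtimes_\alpha S\to A$. *)

(* Defs.v *)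
From HB Require Import structures.
From mathcomp Require Import all_boot all_order all_algebra.
From mathcomp Require Import complex.
From mathcomp Require Import all_classical all_reals all_analysis.

Set Implicit Arguments.
Unset Strict Implicit.
Unset Printing Implicit Defensive.

Import Order.TTheory GRing.Theory Num.Theory.
Import numFieldNormedType.Exports.

Local Open Scope classical_set_scope.
Local Open Scope ring_scope.

(* Unital C*-algebras over the complex numbers R[i].  The norm is a separate
   real-valued field rather than a normedModType structure: Hierarchy Builder
   refuses a join of algType and normedModType.  As everywhere in MathComp,
   algType includes 1 != 0. *)
HB.mixin Record isCStarAlgebra (R : realType) A of GRing.Algebra R[i] A := {
  cnorm : A -> R;
  star : A -> A;
  cnorm_eq0 : forall x : A, cnorm x = 0 -> x = 0;
  ler_cnormD : forall x y : A, cnorm (x + y) <= cnorm x + cnorm y;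
  cnormZ : forall (a : R[i]) (x : A),
    cnorm (a *: x) = ComplexField.Normc.normc a * cnorm x;
  ler_cnormM : forall x y : A, cnorm (x * y) <= cnorm x * cnorm y;
  cnorm_complete : forall x : nat -> A,
    (forall e : R, 0 < e -> exists N : nat, forall m n : nat,
       (N <= m)%N -> (N <= n)%N -> cnorm (x m - x n) < e) ->
    exists l : A, cnorm (x n - l) @[n --> \oo] --> (0 : R);
  starK : involutive star;
  starD : {morph star : x y / x + y};
  starZ : forall (a : R[i]) (x : A), star (a *: x) = a^* *: star x;
  starM : forall x y : A, star (x * y) = star y * star x;
  cnorm_starM : forall x : A, cnorm (star x * x) = cnorm x ^+ 2
}.

#[short(type="cstarAlgType")]
HB.structure Definition CStarAlgebra (R : realType) :=
  {A of isCStarAlgebra R A & GRing.Algebra R[i] A}.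

Section CStarTheory.
Variables (R : realType) (A : cstarAlgType R).
Implicit Types (x y w : A) (S X : set A).

Lemma star0 : star (0 : A) = 0.
Proof. by apply: (addrI (star 0)); rewrite -starD !addr0. Qed.

Lemma star1 : star (1 : A) = 1.
Proof.
by rewrite -[RHS](starK (1 : A)) -[in RHS](mulr1 (star 1)) starM starK mulr1.
Qed.

Lemma starX x n : star (x ^+ n) = star x ^+ n.
Proof.
by elim: n => [|n IHn]; rewrite ?expr0 ?star1// exprS starM IHn -exprSr.
Qed.

Lemma cnorm0 : cnorm (0 : A) = 0.
Proof. by rewrite -(scale0r (0 : A)) cnormZ ComplexField.Normc.normc0 mul0r. Qed.

Lemma cnormN x : cnorm (- x) = cnorm x.
Proof.
rewrite -scaleN1r cnormZ /ComplexField.Normc.normc/=.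
by rewrite sqrrN expr1n oppr0 expr0n/= addr0 sqrtr1 mul1r.
Qed.

Lemma cnorm_ge0 x : 0 <= cnorm x.
Proof.
have := ler_cnormD x (- x).
by rewrite subrr cnorm0 cnormN -mulr2n pmulrn_lge0.
Qed.

(* Sequential closedness, which for a norm topology is closedness. *)
Definition cnorm_closed S : Prop := forall (x : nat -> A) (l : A),
  (forall n, S (x n)) -> cnorm (x n - l) @[n --> \oo] --> (0 : R) -> S l.

Definition csubalg_closed S : Prop :=
  [/\ S 0, forall (a : R[i]) x y, S x -> S y -> S (a *: x + y),
      forall x y, S x -> S y -> S (x * y), forall x, S x -> S (star x)
    & cnorm_closed S].

(* C*(X): the smallest C*-subalgebra containing X, unital or not. *)
Definition csubalg_gen X : set A := smallest csubalg_closed X.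

Lemma csubalg_gen_closed X : csubalg_closed (csubalg_gen X).
Proof.
split=> [S [[S0]]//|a x y Sx Sy S [cS XS]|x y Sx Sy S [cS XS]|x Sx S [cS XS]|
         x l Sx xl S [cS XS]].
- by case: (cS) => _ + _ _ _; apply; [exact: Sx|exact: Sy].
- by case: (cS) => _ _ + _ _; apply; [exact: Sx|exact: Sy].
- by case: (cS) => _ _ _ + _; apply; exact: Sx.
- by case: (cS) => _ _ _ _ /(_ x l); apply=> // n; exact: Sx.
Qed.

End CStarTheory.

Section StarHom.
Variables (R : realType) (A B : cstarAlgType R).

(* Continuity is not required: it is automatic between C*-algebras.  So are
   unitality and isometry of the bijective ones. *)
Definition star_hom (f : A -> B) : Prop :=
  [/\ linear f, {morph f : x y / x * y} & {morph f : x / star x}].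

Definition unital_star_hom (f : A -> B) : Prop := star_hom f /\ f 1 = 1.

Definition cstar_isomorphic : Prop :=
  exists f : A -> B, star_hom f /\ bijective f.

End StarHom.

Section SubCStarAlgebra.
Variables (R : realType) (A : cstarAlgType R).

(* C*-subalgebras containing the unit of A, hence C*-algebras of the class
   above. *)
Record csubalg := CSubalg {
  csubalg_set : set A;
  csubalg1 : csubalg_set 1;
  csubalgP : csubalg_closed csubalg_set
}.

Variable S : csubalg.

Definition csubalg_type : Type := {x : A | x \in csubalg_set S}.

HB.instance Definition _ :=
  SubChoice.copy csubalg_type {x : A | x \in csubalg_set S}.

Let csubalg_subalg : subalg_closed [in csubalg_set S].
Proof.
case: (csubalgP S) => S0 SL SM _ _.
split; first by apply/mem_set; exact: csubalg1.
  by move=> a x y /set_mem Sx /set_mem Sy; apply/mem_set; exact: SL.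
by move=> x y /set_mem Sx /set_mem Sy; apply/mem_set; exact: SM.
Qed.

HB.instance Definition _ := GRing.SubChoice_isSubAlgebra.Build R[i] A
  [in csubalg_set S] csubalg_type csubalg_subalg.

Let nrm (x : csubalg_type) : R := cnorm (val x).

Lemma csubalg_valP (x : csubalg_type) : csubalg_set S (val x).
Proof. by apply: set_mem; exact: (valP x). Qed.

Definition csubalg_in (x : A) (Sx : csubalg_set S x) : csubalg_type :=
  exist _ x (mem_set Sx).

Let str (x : csubalg_type) : csubalg_type :=
  csubalg_in (let: And5 _ _ _ SS _ := csubalgP S in SS _ (csubalg_valP x)).

Let nrm_eq0 x : nrm x = 0 -> x = 0.
Proof. by move=> /cnorm_eq0 x0; apply: val_inj. Qed.

Let nrmD x y : nrm (x + y) <= nrm x + nrm y.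
Proof. exact: ler_cnormD. Qed.

Let nrmZ a x : nrm (a *: x) = ComplexField.Normc.normc a * nrm x.
Proof. exact: cnormZ. Qed.

Let nrmM x y : nrm (x * y) <= nrm x * nrm y.
Proof. exact: ler_cnormM. Qed.

Let nrm_complete (x : nat -> csubalg_type) :
  (forall e : R, 0 < e -> exists N : nat, forall m n : nat,
     (N <= m)%N -> (N <= n)%N -> nrm (x m - x n) < e) ->
  exists l, nrm (x n - l) @[n --> \oo] --> (0 : R).
Proof.
move=> cx; have [l xl] := @cnorm_complete R A (fun n => val (x n)) cx.
have Sl : csubalg_set S l.
  case: (csubalgP S) => _ _ _ _; apply; last exact: xl.
  by move=> n; exact: csubalg_valP.
by exists (csubalg_in Sl).
Qed.

Let strK : involutive str.
Proof. by move=> x; apply: val_inj; exact: starK. Qed.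

Let strD : {morph str : x y / x + y}.
Proof. by move=> x y; apply: val_inj; exact: starD. Qed.

Let strZ (a : R[i]) x : str (a *: x) = a^* *: str x.
Proof. by apply: val_inj; exact: starZ. Qed.

Let strM x y : str (x * y) = str y * str x.
Proof. by apply: val_inj; exact: starM. Qed.

Let nrm_strM x : nrm (str x * x) = nrm x ^+ 2.
Proof. exact: cnorm_starM. Qed.

HB.instance Definition _ := isCStarAlgebra.Build R csubalg_type
  nrm_eq0 nrmD nrmZ nrmM nrm_complete strK strD strZ strM nrm_strM.

End SubCStarAlgebra.

Section SemigroupCrossedProduct.
Variables (R : realType) (S : semigroupType) (D : cstarAlgType R).

Record cstar_action := CStarAction {
  act : S -> D -> D;
  act_hom : forall p, star_hom (act p);
  actM : forall p q x, act (p * q)%g x = act p (act q x)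
}.

Definition covariant (alpha : cstar_action) (A : cstarAlgType R)
    (pi : D -> A) (rho : S -> A) : Prop :=
  [/\ unital_star_hom pi,
      forall p, star (rho p) * rho p = 1,
      forall p q, rho (p * q)%g = rho p * rho q
    & forall p x, rho p * pi x * star (rho p) = pi (act alpha p x)].

Definition is_crossed_product (alpha : cstar_action) (P : cstarAlgType R)
    (iotaD : D -> P) (iotaS : S -> P) : Prop :=
  [/\ covariant alpha iotaD iotaS,
      csubalg_gen (range iotaD `|` range iotaS) = setT
    & forall (A : cstarAlgType R) (pi : D -> A) (rho : S -> A),
        covariant alpha pi rho ->
        exists! psi : P -> A,
          [/\ star_hom psi, forall x, psi (iotaD x) = pi x
            & forall p, psi (iotaS p) = rho p]].

End SemigroupCrossedProduct.

(* phi only selects the product of the semigroup structure below. *)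
Definition sdprodN (G : groupType) (phi : {multiplicative G -> G}) : Type :=
  (G * nat)%type.

Section SemidirectProduct.
Variables (G : groupType) (phi : {multiplicative G -> G}).

HB.instance Definition _ := Choice.copy (sdprodN phi) (G * nat)%type.

Definition sdprodN_mul (p q : sdprodN phi) : sdprodN phi :=
  ((p.1 * iter p.2 phi q.1)%g, (p.2 + q.2)%N).

Lemma iter_phiM n (g h : G) :
  iter n phi (g * h)%g = (iter n phi g * iter n phi h)%g.
Proof. by elim: n => //= n ->; rewrite gmulfM. Qed.

Let sdprodN_mulA : associative sdprodN_mul.
Proof.
move=> [g n] [h m] [k l].
by rewrite /sdprodN_mul/= iter_phiM iterD mulgA addnA.
Qed.

HB.instance Definition _ := isSemigroup.Build (sdprodN phi) sdprodN_mulA.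

End SemidirectProduct.

Section Constructible.
Variables (G : groupType) (phi : {multiplicative G -> G}).

Definition ltranslate (g : G) (X : set G) : set G := [set (g * x)%g | x in X].

Definition infinite_cokernel : Prop :=
  infinite_set [set ltranslate g (range phi) | g in [set: G]].

(* Binary unions and intersections suffice: when G is in the collection,
   complements provide the empty union. *)
Definition constructible_closed (C : set (set G)) : Prop :=
  [/\ forall X Y, C X -> C Y -> C (X `|` Y),
      forall X Y, C X -> C Y -> C (X `&` Y),
      forall X, C X -> C (~` X),
      forall X, C X -> C (phi @` X)
    & forall g X, C X -> C (ltranslate g X)].

Definition constructible (B : set (set G)) : set (set G) :=
  smallest constructible_closed B.

End Constructible.

Section UniversalAlgebra.
Variables (R : realType) (G : groupType) (phi : {multiplicative G -> G}).
Variable B : set (set G).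

Local Notation CB := (constructible phi B).

(* The generators e_[X] are indexed by X in C(B): the values of gen_e outside
   C(B) are irrelevant and no condition below mentions them. *)
Record Urep (A : cstarAlgType R) := URep {
  gen_e : set G -> A;
  gen_u : G -> A;
  gen_s : A;
  gen_e_proj : forall X, CB X ->
    star (gen_e X) = gen_e X /\ gen_e X * gen_e X = gen_e X;
  gen_u_unitary : forall g,
    star (gen_u g) * gen_u g = 1 /\ gen_u g * star (gen_u g) = 1;
  gen_s_isometry : star gen_s * gen_s = 1;
  gen_usus : forall g h n m, gen_u g * gen_s ^+ n * gen_u h * gen_s ^+ m
    = gen_u (g * iter n phi h)%g * gen_s ^+ (n + m);
  gen_usesu : forall g n X, CB X ->
    gen_u g * gen_s ^+ n * gen_e X * star gen_s ^+ n * gen_u g^-1%g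
    = gen_e (ltranslate g (iter n phi @` X));
  gen_eT : gen_e setT = 1;
  gen_e0 : gen_e set0 = 0;
  gen_eI : forall X Y, CB X -> CB Y -> gen_e X * gen_e Y = gen_e (X `&` Y);
  gen_eU : forall X Y, CB X -> CB Y ->
    gen_e X + gen_e Y = gen_e (X `|` Y) + gen_e (X `&` Y)
}.

Definition is_universal (U : cstarAlgType R) (r : Urep U) : Prop :=
  csubalg_gen (gen_e r @` CB `|` range (gen_u r) `|` [set gen_s r]) = setT /\
  forall (A : cstarAlgType R) (r' : Urep A), exists! psi : U -> A,
    [/\ star_hom psi, forall X, CB X -> psi (gen_e r X) = gen_e r' X,
        forall g, psi (gen_u r g) = gen_u r' g & psi (gen_s r) = gen_s r'].

Variables (U : cstarAlgType R) (r : Urep U).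
Local Notation e := (gen_e r).
Local Notation u := (gen_u r).
Local Notation s := (gen_s r).

Definition conj_us (p : sdprodN phi) (x : U) : U :=
  u p.1 * s ^+ p.2 * x * star s ^+ p.2 * u p.1^-1%g.

Definition D_gens : set U :=
  [set x | exists (g : G) (n : nat) (H : set G),
     B H /\ x = u g * s ^+ n * e H * star s ^+ n * u g^-1%g].

Let u_unit_idem : u 1%g = 1.
Proof.
have := gen_usus r 1%g 1%g 0 0; rewrite /= !expr0 !mulr1 mulg1 => u11.
have [uu _] := gen_u_unitary r 1%g.
by rewrite -[LHS]mul1r -[in LHS]uu -mulrA u11 uu.
Qed.

Let uM g h : u g * u h = u (g * h)%g.
Proof. by have := gen_usus r g h 0 0; rewrite /= !expr0 !mulr1. Qed.

Lemma gen_uV g : u g^-1%g = star (u g).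
Proof.
have [uu _] := gen_u_unitary r g.
by rewrite -[LHS]mul1r -uu -mulrA uM mulgV u_unit_idem mulr1.
Qed.

Let us (p : sdprodN phi) : U := u p.1 * s ^+ p.2.

Let conj_usE p x : conj_us p x = us p * x * star (us p).
Proof. by rewrite /conj_us /us gen_uV starM starX !mulrA. Qed.

Let us_isometry p : star (us p) * us p = 1.
Proof.
have [uu _] := gen_u_unitary r p.1.
rewrite /us starM mulrA -[X in X * _]mulrA uu mulr1 starX.
elim: p.2 => [|n IHn]; first by rewrite !expr0 mulr1.
by rewrite exprSr exprS mulrA -[X in X * _]mulrA gen_s_isometry mulr1.
Qed.

Let usM p q : us (p * q)%g = us p * us q.
Proof. by rewrite /us mulrA gen_usus. Qed.

Lemma conj_us_hom p : star_hom (conj_us p).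
Proof.
split=> [a x y|x y|x].
- by rewrite !conj_usE mulrDr mulrDl -scalerAr -scalerAl.
- rewrite !conj_usE; move: (us p) (us_isometry p) => w ww.
  by rewrite !mulrA -[in RHS](mulrA _ _ w) ww mulr1.
- by rewrite !conj_usE; move: (us p) => w; rewrite !starM starK mulrA.
Qed.

Lemma conj_usM p q x : conj_us (p * q)%g x = conj_us p (conj_us q x).
Proof. by rewrite !conj_usE usM starM !mulrA. Qed.

Lemma D_conj_us p x : csubalg_gen D_gens x -> csubalg_gen D_gens (conj_us p x).
Proof.
have [cL cM cS] := conj_us_hom p.
have [D0 DL DM DS Dc] := csubalg_gen_closed D_gens.
suff: csubalg_gen D_gens `<=` [set x | csubalg_gen D_gens (conj_us p x)].
  exact.
apply: smallest_sub.
  split=> /= [|a y z Dy Dz|y z Dy Dz|y Dy|y l Dy yl].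
  - by rewrite conj_usE mulr0 mul0r.
  - by rewrite cL; exact: DL.
  - by rewrite cM; exact: DM.
  - by rewrite cS; exact: DS.
  - apply: (Dc (fun n => conj_us p (y n)) _ Dy).
    have cB n : conj_us p (y n) - conj_us p l = us p * (y n - l) * star (us p).
      by rewrite !conj_usE -mulrBl -mulrBr.
    apply: (@squeeze_cvgr _ _ _ _ (fun=> 0)
      (fun n => cnorm (us p) * cnorm (y n - l) * cnorm (star (us p)))).
    + apply: nearW => n; rewrite cnorm_ge0 cB /=.
      apply: le_trans (ler_cnormM _ _) _.
      by apply: ler_wpM2r; [exact: cnorm_ge0|exact: ler_cnormM].
    + exact: cvg_cst.
    + rewrite -[X in _ --> X](mul0r (cnorm (star (us p)))).
      apply: cvgM; last exact: cvg_cst.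
      rewrite -[X in _ --> X](mulr0 (cnorm (us p))).
      by apply: cvgM => //; exact: cvg_cst.
move=> _ [g [n [H [BH ->]]]] /=.
rewrite (_ : _ * u _ = conj_us (g, n) (e H))// -conj_usM.
by apply: sub_gen_smallest; exists (p * (g, n))%g.1, (p * (g, n))%g.2, H.
Qed.

Hypothesis BT : B setT.

Let D1 : csubalg_gen D_gens 1.
Proof.
apply: sub_gen_smallest; exists 1%g, 0%N, setT; split => //.
by rewrite !expr0 gen_eT !mulr1 uM mulgV u_unit_idem.
Qed.

Definition Dalg : csubalg U := CSubalg D1 (csubalg_gen_closed D_gens).

Definition alpha_fun (p : sdprodN phi) (x : csubalg_type Dalg) :
    csubalg_type Dalg :=
  @csubalg_in R U Dalg _ (D_conj_us p (csubalg_valP x)).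

Lemma val_alpha_fun p x : val (alpha_fun p x) =
  u p.1 * s ^+ p.2 * val x * star s ^+ p.2 * u p.1^-1%g.
Proof. by []. Qed.

Let alpha_hom p : star_hom (alpha_fun p).
Proof.
have [cL cM cS] := conj_us_hom p.
split=> [a x y|x y|x]; apply: val_inj; [exact: cL|exact: cM|exact: cS].
Qed.

Let alphaM p q x : alpha_fun (p * q)%g x = alpha_fun p (alpha_fun q x).
Proof. by apply: val_inj; exact: conj_usM. Qed.

Definition alpha : cstar_action (sdprodN phi) (csubalg_type Dalg) :=
  CStarAction alpha_hom alphaM.

End UniversalAlgebra.

(* Main.v *)
Require Import Defs.
From HB Require Import structures.
From mathcomp Require Import all_boot all_order all_algebra.
From mathcomp Require Import complex.
From mathcomp Require Import all_classical all_reals all_analysis.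
From mathcomp Require Import lra.

Set Implicit Arguments.
Unset Strict Implicit.
Unset Printing Implicit Defensive.

Local Open Scope classical_set_scope.

(** The algebra U and the crossed product P present the same data in two ways,
    and each universal property provides one half of the isomorphism.

    Every projection e_X with X in C(B) already lies in D: the sets X in C(B)
    with e_X in D contain B, are stable under intersections, complements and
    unions because D is a unital algebra, and under translations and images by
    phi because D is invariant under the isometries u_g s^n ([gen_e_in_D]).
    Hence a covariant pair (pi, rho) of (D, S) produces a representation of the
    generators of U, namely pi(e_X), rho(g, 0) and rho(1, 1) ([cov_Urep]): here
    rho(1, 0) is an idempotent isometry, so it is 1 and the rho(g, 0) are
    unitary.  Conversely the inclusion of D in U together with
    (g, n) |-> u_g s^n is covariant ([covariant_val]).  The universal
    properties give f : U -> P and g : P -> U, and the uniqueness clauses make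
    both composites the identity, as soon as they fix the generators.

    The one analytic point is that f must agree with iota_D on all of D,
    whereas the relations only give this on the generating projections of D.
    As D is the closed algebra they generate, this needs star homomorphisms to
    be continuous ([star_hom_contractive]).  The argument avoids spectral
    theory.  A self-adjoint a with norm less than 1 has 1 - a^2 = d^2 with d
    self-adjoint and commuting with a, where d is the solution of a contractive
    fixed-point equation ([selfadjoint_sqrt]); so a is the real part of the
    unitary w = a + i d ([selfadjoint_re_unitary]).  A star homomorphism sends
    w to an element of norm at most 1, because w^* w = 1 is sent to a
    projection, and therefore sends a to an element of norm at most 1. *)

(** * Limits for the norm of a C*-algebra *)

Section NormConvergence.
Import Order.TTheory GRing.Theory Num.Theory numFieldNormedType.Exports.
Local Open Scope ring_scope.
Variables (R : realType) (A : cstarAlgType R).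
Implicit Types (a b x y l : A) (u v : nat -> A).

Definition cnorm_cvg u l : Prop := cnorm (u n - l) @[n --> \oo] --> (0 : R).

Lemma cnormB x y : cnorm (x - y) = cnorm (y - x).
Proof. by rewrite -cnormN opprB. Qed.

Lemma cnorm_cvg_dominated u l (d : R^nat) :
  (forall n, cnorm (u n - l) <= d n) -> d n @[n --> \oo] --> (0 : R) ->
  cnorm_cvg u l.
Proof.
move=> ud d0; apply: (@squeeze_cvgr _ _ _ _ (fun=> 0) d) => //; last exact: cvg_cst.
by apply: nearW => n; rewrite cnorm_ge0 ud.
Qed.

Lemma cnorm_cvg_unique u l l' : cnorm_cvg u l -> cnorm_cvg u l' -> l = l'.
Proof.
move=> ul ul'; apply/eqP; rewrite -subr_eq0; apply/eqP/cnorm_eq0.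
apply/eqP; rewrite eq_le cnorm_ge0 andbT.
have h : cnorm (u n - l) + cnorm (u n - l') @[n --> \oo] --> (0 + 0 : R).
  exact: cvgD.
rewrite addr0 in h.
rewrite -(cvg_lim (@Rhausdorff R) h).
apply: limr_ge; first by apply/cvg_ex; exists 0.
apply: nearW => n; rewrite (_ : l - l' = (l - u n) + (u n - l')).
  by rewrite (cnormB (u n) l); exact: ler_cnormD.
by rewrite addrA subrK.
Qed.

Lemma cnorm_cvg_cst l : cnorm_cvg (fun=> l) l.
Proof. by rewrite /cnorm_cvg subrr cnorm0; exact: cvg_cst. Qed.

Lemma cnorm_cvgD u v l l' :
  cnorm_cvg u l -> cnorm_cvg v l' -> cnorm_cvg (fun n => u n + v n) (l + l').
Proof.
move=> ul vl'.
apply: (@cnorm_cvg_dominated _ _ (fun n => cnorm (u n - l) + cnorm (v n - l'))).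
  by move=> n; rewrite opprD addrACA; exact: ler_cnormD.
by rewrite -[X in _ --> X](addr0 (0 : R)); exact: cvgD.
Qed.

Lemma cnorm_cvgZ (c : R[i]) u l :
  cnorm_cvg u l -> cnorm_cvg (fun n => c *: u n) (c *: l).
Proof.
move=> ul.
apply: (@cnorm_cvg_dominated _ _
  (fun n => ComplexField.Normc.normc c * cnorm (u n - l))).
  by move=> n; rewrite -scalerBr cnormZ.
rewrite -[X in _ --> X](mulr0 (ComplexField.Normc.normc c)).
by apply: cvgM => //; exact: cvg_cst.
Qed.

Lemma cnorm_cvgM u v l l' :
  cnorm_cvg u l -> cnorm_cvg v l' -> cnorm_cvg (fun n => u n * v n) (l * l').
Proof.
move=> ul vl'.
apply: (@cnorm_cvg_dominated _ _ (fun n =>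
  cnorm (u n - l) * cnorm (v n - l') +
  (cnorm (u n - l) * cnorm l' + cnorm l * cnorm (v n - l')))).
  move=> n; rewrite (_ : u n * v n - l * l' =
    (u n - l) * (v n - l') + ((u n - l) * l' + l * (v n - l'))).
    apply: le_trans (ler_cnormD _ _) (lerD (ler_cnormM _ _) _).
    exact: le_trans (ler_cnormD _ _) (lerD (ler_cnormM _ _) (ler_cnormM _ _)).
  by rewrite addrA -mulrDr subrK mulrBl mulrBr addrA subrK.
rewrite [X in _ --> X](_ : 0 = 0 * 0 + (0 * cnorm l' + cnorm l * 0)); last first.
  by rewrite !mul0r mulr0 !addr0.
apply: cvgD; first exact: cvgM.
by apply: cvgD; apply: cvgM => //; exact: cvg_cst.
Qed.

Lemma starN x : star (- x) = - star x.
Proof. by apply/eqP; rewrite -addr_eq0 -starD addNr star0. Qed.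

Lemma starB x y : star (x - y) = star x - star y.
Proof. by rewrite starD starN. Qed.

(** The C*-identity gives |y|^2 = |y^* y| <= |y^*| |y|, so |y| <= |y^*|, and the
    involution gives the converse. *)
Lemma cnorm_star x : cnorm (star x) = cnorm x.
Proof.
suff le y : cnorm y <= cnorm (star y).
  by apply/eqP; rewrite eq_le le -{2}(starK x) le.
have [y0|y0] := eqVneq (cnorm y) 0; first by rewrite y0 cnorm_ge0.
have ygt0 : 0 < cnorm y by rewrite lt_def y0 cnorm_ge0.
by rewrite -(ler_pM2r ygt0) -expr2 -cnorm_starM ler_cnormM.
Qed.

Lemma cnorm_cvg_star u l :
  cnorm_cvg u l -> cnorm_cvg (fun n => star (u n)) (star l).
Proof.
by move=> ul; apply: (cnorm_cvg_dominated _ ul) => n; rewrite -starB cnorm_star.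
Qed.

Lemma cnorm_cvg_shift u l : cnorm_cvg u l -> cnorm_cvg (fun n => u n.+1) l.
Proof. by move=> ul; rewrite /cnorm_cvg (cvg_shiftS (fun n => cnorm (u n - l))). Qed.

Lemma normc_real (r : R) : 0 <= r -> ComplexField.Normc.normc r%:C%C = r.
Proof.
move=> r0; rewrite /ComplexField.Normc.normc /=.
by rewrite expr0n /= addr0 sqrtr_sqr ger0_norm.
Qed.

Lemma conjc_real (r : R) : (r%:C%C)^* = r%:C%C.
Proof. by rewrite conj_Creal// complex_real. Qed.

(** * Self-adjoint contractions are real parts of unitaries *)

Local Notation half := ((2^-1 : R)%:C%C : R[i]).

Let halfD x : half *: x + half *: x = x.
Proof. by rewrite -scalerDl -rmorphD/= -[2^-1]div1r -splitr scale1r. Qed.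

Let cnorm_half x : cnorm (half *: x) = 2^-1 * cnorm x.
Proof. by rewrite cnormZ normc_real. Qed.

(** With d = 1 - l the equation a^2 + d^2 = 1 becomes l = (l^2 + a^2) / 2.  The
    right-hand side preserves the ball of radius q = |a| and is q-Lipschitz on
    it, so its iterates from 0 converge to a solution; they are polynomials in
    a with real coefficients, whence the symmetry of l and its commutation
    with a. *)
Lemma selfadjoint_sqrt a : star a = a -> cnorm a < 1 ->
  exists d, [/\ star d = d, d * a = a * d & a * a + d * d = 1].
Proof.
move=> sa a1; set q := cnorm a in a1.
have q0 : 0 <= q by exact: cnorm_ge0.
pose T x := half *: (x * x + a * a).
pose k n := iter n T 0.
have kS n : k n.+1 = T (k n) by [].
have kq n : cnorm (k n) <= q.
  elim: n => [|n IHn]; first by rewrite cnorm0.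
  rewrite kS cnorm_half.
  have := ler_cnormD (k n * k n) (a * a).
  have := ler_cnormM (k n) (k n); have := ler_cnormM a a.
  rewrite -/q; have := cnorm_ge0 (k n); nra.
have TB x y : cnorm x <= q -> cnorm y <= q ->
    cnorm (T x - T y) <= q * cnorm (x - y).
  move=> xq yq.
  rewrite /T -scalerBr cnorm_half opprD addrACA subrr addr0.
  rewrite (_ : x * x - y * y = (x - y) * x + y * (x - y)); last first.
    by rewrite mulrBl mulrBr addrA subrK.
  have := ler_cnormD ((x - y) * x) (y * (x - y)).
  have := ler_cnormM (x - y) x; have := ler_cnormM y (x - y).
  have := cnorm_ge0 (x - y); nra.
(* Comparing k (n + j) with k n directly, by induction on n, makes the
   sequence Cauchy without summing a geometric series. *)
have kB n j : cnorm (k (n + j)%N - k n) <= q ^+ n.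
  elim: n => [|n IHn].
    by rewrite add0n expr0 subr0 (le_trans (kq j)) ?ltW.
  rewrite addSn !kS exprS; apply: le_trans (TB _ _ (kq _) (kq _)) _.
  exact: ler_wpM2l.
have qcvg : q ^+ n @[n --> \oo] --> (0 : R) by apply: cvg_expr; rewrite ger0_norm.
have [l kl] : exists l, cnorm_cvg k l.
  apply: cnorm_complete => e e0.
  have [N _ Nq] := cvgr0_norm_lt _ qcvg e e0.
  have {}Nq n : (N <= n)%N -> q ^+ n < e.
    by move=> /Nq /=; apply: le_lt_trans; exact: ler_norm.
  exists N => m n Nm Nn.
  wlog mn : m n Nm Nn / (m <= n)%N.
    move=> h; have [/h|/ltnW/h] := leqP m n; first exact.
    by rewrite cnormB; exact.
  rewrite cnormB -(subnKC mn); exact: le_lt_trans (kB _ _) (Nq _ Nm).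
have Tl : T l = l.
  apply: (@cnorm_cvg_unique (fun n => k n.+1)); last exact: cnorm_cvg_shift.
  apply: cnorm_cvgZ; apply: cnorm_cvgD; last exact: cnorm_cvg_cst.
  exact: cnorm_cvgM.
have sl : star l = l.
  apply: (@cnorm_cvg_unique k) => //.
  rewrite (_ : k = fun n => star (k n)); first exact: cnorm_cvg_star.
  apply/funext; elim=> [|n IHn]; first by rewrite star0.
  by rewrite kS /T starZ starD !starM -IHn sa conjc_real.
have la : l * a = a * l.
  apply: (@cnorm_cvg_unique (fun n => k n * a)).
    by apply: cnorm_cvgM => //; exact: cnorm_cvg_cst.
  rewrite (_ : (fun n => k n * a) = (fun n => a * k n)).
    by apply: cnorm_cvgM => //; exact: cnorm_cvg_cst.
  apply/funext; elim=> [|n IHn]; first by rewrite mul0r mulr0.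
  rewrite kS /T -scalerAl -scalerAr mulrDl mulrDr mulrA.
  by rewrite -(mulrA (k n)) IHn mulrA IHn mulrA.
exists (1 - l); split.
- by rewrite starB star1 sl.
- by rewrite mulrBl mulrBr mul1r mulr1 la.
- have ll : l + l = l * l + a * a by rewrite -{1 2}Tl; exact: halfD.
  rewrite mulrBl mul1r mulrBr mulr1 opprB addrACA -opprD ll.
  by rewrite opprD [1 + _ + _]addrA addrK addrCA subrr addr0.
Qed.

(** The witness is w = a + i d with d from [selfadjoint_sqrt]: the cross terms of
    w^* w cancel because a and d commute, which leaves a^2 + d^2 = 1. *)
Lemma selfadjoint_re_unitary a : star a = a -> cnorm a < 1 ->
  exists w, star w * w = 1 /\ a = half *: (w + star w).
Proof.
move=> sa a1; have [d [sd da ad1]] := selfadjoint_sqrt sa a1.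
have sw : star (a + 'i%C *: d) = a - 'i%C *: d.
  rewrite starD starZ sa sd (_ : ('i%C : R[i])^* = - 'i%C) ?scaleNr //.
  by rewrite /Num.conj /=; congr Complex; rewrite ?oppr0.
exists (a + 'i%C *: d); rewrite sw; split.
  rewrite mulrBl !mulrDr -!scalerAl -!scalerAr da opprD addrA addrK.
  by rewrite scalerA -(expr2 'i%C) sqr_i scaleN1r opprK.
by rewrite addrACA subrr addr0 scalerDr halfD.
Qed.

End NormConvergence.

(** * Star homomorphisms are contractive *)

Section AutomaticContinuity.
Import Order.TTheory GRing.Theory Num.Theory numFieldNormedType.Exports.
Local Open Scope ring_scope.
Variables (R : realType) (A B : cstarAlgType R) (f : A -> B).
Hypothesis f_hom : star_hom f.

Let fM : {morph f : x y / x * y}. Proof. by case: f_hom. Qed.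
Let fS : {morph f : x / star x}. Proof. by case: f_hom. Qed.

Lemma star_hom0 : f 0 = 0.
Proof.
case: f_hom => fL _ _; have := fL 1 0 0; rewrite !scale1r !addr0 => f00.
by apply: (addrI (f 0)); rewrite addr0 -f00.
Qed.

Lemma star_homD : {morph f : x y / x + y}.
Proof. by case: f_hom => fL _ _ x y; have := fL 1 x y; rewrite !scale1r. Qed.

Lemma star_homZ c : {morph f : x / c *: x}.
Proof. by case: f_hom => fL _ _ x; have := fL c x 0; rewrite star_hom0 !addr0. Qed.

Lemma star_homB : {morph f : x y / x - y}.
Proof. by move=> x y; rewrite -scaleN1r star_homD star_homZ scaleN1r. Qed.

(* f need not be unital, but f 1 is a projection. *)
Let cnorm_f1 : cnorm (f 1) <= 1.
Proof.
have : cnorm (f 1) ^+ 2 = cnorm (f 1) by rewrite -cnorm_starM -fS -fM star1 mulr1.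
have := cnorm_ge0 (f 1); nra.
Qed.

Let contractive_selfadjoint1 a : star a = a -> cnorm a < 1 -> cnorm (f a) <= 1.
Proof.
move=> sa a1; have [w [ww ->]] := selfadjoint_re_unitary sa a1.
have fw : cnorm (f w) <= 1.
  have := cnorm_starM (f w); rewrite -fS -fM ww.
  have := cnorm_f1; have := cnorm_ge0 (f w); nra.
rewrite star_homZ star_homD fS cnormZ normc_real//.
have := ler_cnormD (f w) (star (f w)); rewrite cnorm_star; lra.
Qed.

(* Rescale a into the open unit ball by any constant slightly above its norm. *)
Let contractive_selfadjoint a : star a = a -> cnorm (f a) <= cnorm a.
Proof.
move=> sa; apply/ler_addgt0Pr => e e0.
have t0 : 0 < cnorm a + e by rewrite ltr_wpDl// cnorm_ge0.
have ti0 : 0 <= (cnorm a + e)^-1 by rewrite invr_ge0 ltW.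
have := @contractive_selfadjoint1 ((cnorm a + e)^-1%:C%C *: a).
rewrite starZ conjc_real sa star_homZ !cnormZ normc_real// => /(_ erefl).
rewrite ltr_pdivrMl// mulr1 ltrDl => /(_ e0).
by rewrite ler_pdivrMl// mulr1.
Qed.

(** The self-adjoint case applied to x^* x, by the C*-identity on both sides. *)
Lemma star_hom_contractive x : cnorm (f x) <= cnorm x.
Proof.
rewrite -(@ler_pXn2r _ 2)// ?nnegrE ?cnorm_ge0// -!cnorm_starM -fS -fM.
by apply: contractive_selfadjoint; rewrite starM starK.
Qed.

Lemma star_hom_cvg (u : nat -> A) l : cnorm_cvg u l -> cnorm_cvg (f \o u) (f l).
Proof.
move=> ul; apply: (cnorm_cvg_dominated _ ul) => n /=.
by rewrite -star_homB star_hom_contractive.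
Qed.

End AutomaticContinuity.

Section AgreeOnGenerators.
Import Order.TTheory GRing.Theory Num.Theory.
Local Open Scope ring_scope.
Variables (R : realType) (U A : cstarAlgType R).

(** The equalizer of f and g is a C*-subalgebra, by continuity.  It is formed
    inside the ambient algebra U because that is where C*(X) is defined. *)
Lemma star_hom_eq_on_gens (S : csubalg U) (X : set U) (f g : csubalg_type S -> A) :
  csubalg_set S = csubalg_gen X -> star_hom f -> star_hom g ->
  (forall x, X (val x) -> f x = g x) ->
  f =1 g.
Proof.
move=> SX fh gh fg x.
have [S0 SL SM SS Sc] := csubalgP S.
pose E := [set y | exists Sy : csubalg_set S y,
  f (csubalg_in Sy) = g (csubalg_in Sy)].
suff SE : csubalg_set S `<=` E.
  have [Sx] := SE _ (csubalg_valP x).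
  by rewrite (_ : csubalg_in Sx = x)//; exact: val_inj.
have [fL fM fS] := fh; have [gL gM gS] := gh.
have inE y (Sy : csubalg_set S y) z : val z = y -> f z = g z ->
    f (csubalg_in Sy) = g (csubalg_in Sy).
  by move=> zy; rewrite (_ : csubalg_in Sy = z)//; apply: val_inj.
rewrite SX; apply: smallest_sub; last first.
  move=> y Xy; have Sy : csubalg_set S y by rewrite SX; exact: sub_gen_smallest.
  by exists Sy; exact: fg.
split.
- exists S0; apply: (inE _ _ 0) => //.
  by rewrite (star_hom0 fh) (star_hom0 gh).
- move=> c y z [Sy fgy] [Sz fgz]; exists (SL c _ _ Sy Sz).
  by apply: (inE _ _ (c *: csubalg_in Sy + csubalg_in Sz)) => //; rewrite fL gL fgy fgz.
- move=> y z [Sy fgy] [Sz fgz]; exists (SM _ _ Sy Sz).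
  by apply: (inE _ _ (csubalg_in Sy * csubalg_in Sz)) => //; rewrite fM gM fgy fgz.
- move=> y [Sy fgy]; exists (SS _ Sy).
  by apply: (inE _ _ (star (csubalg_in Sy))) => //; rewrite fS gS fgy.
- move=> y l Ey yl.
  have Sl : csubalg_set S l by apply: (Sc y) => // n; have [] := Ey n.
  exists Sl; pose v n := csubalg_in (projT1 (cid (Ey n))).
  have vl : cnorm_cvg v (csubalg_in Sl) by exact: yl.
  apply: (@cnorm_cvg_unique _ _ (f \o v)); first exact: star_hom_cvg.
  rewrite (_ : f \o v = g \o v); first exact: star_hom_cvg.
  by apply/funext => n /=; rewrite /v; case: cid.
Qed.

End AgreeOnGenerators.

(** * Isometries and star homomorphisms *)

Section Isometries.
Import GRing.Theory.
Local Open Scope ring_scope.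
Variables (R : realType) (A : cstarAlgType R).
Implicit Types v w : A.

Lemma idempotent_isometry w : star w * w = 1 -> w * w = w -> w = 1.
Proof. by move=> w1 ww; rewrite -[LHS]mul1r -w1 -mulrA ww. Qed.

Lemma isometry_rinv v w : star w * w = 1 -> w * v = 1 -> v = star w.
Proof. by move=> w1 wv; rewrite -[LHS]mul1r -w1 -mulrA wv mulr1. Qed.

Lemma isometryM v w :
  star v * v = 1 -> star w * w = 1 -> star (v * w) * (v * w) = 1.
Proof. by move=> v1 w1; rewrite starM mulrA -(mulrA _ _ v) v1 mulr1. Qed.

Lemma isometryX w n : star w * w = 1 -> star (w ^+ n) * w ^+ n = 1.
Proof.
move=> w1; elim: n => [|n IHn]; first by rewrite expr0 star1 mulr1.
by rewrite exprS; exact: isometryM.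
Qed.

End Isometries.

Section StarHomLemmas.
Import GRing.Theory.
Local Open Scope ring_scope.
Variables (R : realType) (A B C : cstarAlgType R).

Lemma star_hom_comp (f : A -> B) (g : B -> C) :
  star_hom f -> star_hom g -> star_hom (g \o f).
Proof.
move=> [fL fM fS] [gL gM gS].
by split=> [a x y|x y|x] /=; rewrite ?fL ?gL ?fM ?gM ?fS ?gS.
Qed.

Lemma unital_star_homX (f : A -> B) n :
  unital_star_hom f -> {morph f : x / x ^+ n}.
Proof.
move=> [[_ fM _] f1] x; elim: n => [|n IHn]; first by rewrite !expr0 f1.
by rewrite !exprS fM IHn.
Qed.

End StarHomLemmas.

(** * Constructible sets *)

Section ConstructibleSets.
Variables (G : groupType) (phi : {multiplicative G -> G}) (B : set (set G)).
Local Notation CB := (constructible phi B).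
Local Notation S := (sdprodN phi).

Lemma phi1 : phi 1%g = 1%g.
Proof. by apply: (mulgI (phi 1%g)); rewrite -gmulfM !mulg1. Qed.

Lemma sdprodN_mulE (p q : S) :
  (p * q)%g = ((p.1 * iter p.2 phi q.1)%g, (p.2 + q.2)%N) :> S.
Proof. by []. Qed.

Lemma constructible_closedP : constructible_closed phi CB.
Proof.
split=> [X Y CX CY C [cC BC]|X Y CX CY C [cC BC]|X CX C [cC BC]|X CX C [cC BC]|
  g X CX C [cC BC]]; case: (cC) => cU cI cC' cphi cg.
- by apply: cU; [exact: CX|exact: CY].
- by apply: cI; [exact: CX|exact: CY].
- by apply: cC'; exact: CX.
- by apply: cphi; exact: CX.
- by apply: cg; exact: CX.
Qed.

Lemma sub_constructible : B `<=` CB.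
Proof. exact: sub_gen_smallest. Qed.

Lemma constructible_us g n X :
  CB X -> CB (ltranslate g (iter n phi @` X)).
Proof.
have [_ _ _ cphi cg] := constructible_closedP.
move=> CX; apply: cg; elim: n => [|n IHn]; first by rewrite image_id.
by rewrite (_ : iter n.+1 phi = phi \o iter n phi)// -image_comp; exact: cphi.
Qed.

Lemma ltranslate1 (X : set G) : ltranslate 1%g X = X.
Proof. by rewrite /ltranslate (eq_imagel (f' := id)) ?image_id// => x _; rewrite mul1g. Qed.

End ConstructibleSets.

(** * From covariant pairs to representations of the generators, and back *)

Section CovariantRepresentations.
Import GRing.Theory.
Local Open Scope ring_scope.
Variables (R : realType) (G : groupType) (phi : {multiplicative G -> G}).
Variables (B : set (set G)) (BT : B [set: G]).
Variables (U : cstarAlgType R) (r : Urep phi B U).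

Local Notation CB := (constructible phi B).
Local Notation e := (gen_e r).
Local Notation u := (gen_u r).
Local Notation s := (gen_s r).
Local Notation D := (csubalg_type (Dalg r BT)).
Local Notation S := (sdprodN phi).

Lemma gen_e_setC X : CB X -> e (~` X) = 1 - e X.
Proof.
move=> CX; have [_ _ CC _ _] := constructible_closedP phi B.
have := gen_eU r CX (CC _ CX); rewrite setUCr setICr gen_eT gen_e0 addr0 => <-.
by rewrite addrAC subrr add0r.
Qed.

(** The induction over C(B) carries membership in C(B) along, since the relations
    between the e_X hold only there.  Intersections become products, unions and
    complements linear combinations, and translations and images by phi become
    the action of S on D. *)
Lemma gen_e_in_D X : CB X -> csubalg_gen (D_gens r) (e X).
Proof.
have [_ DL DM _ _] := csubalg_gen_closed (D_gens r).
have [cU cI cC cphi cg] := constructible_closedP phi B.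
have D1 : csubalg_gen (D_gens r) 1 := csubalg1 (Dalg r BT).
have Dact g n Y : CB Y -> csubalg_gen (D_gens r) (e Y) ->
    csubalg_gen (D_gens r) (e (ltranslate g (iter n phi @` Y))).
  by move=> CY DY; rewrite -gen_usesu//; exact: (D_conj_us (g, n)).
suff : CB `<=` [set X | CB X /\ csubalg_gen (D_gens r) (e X)] by move=> h /h [].
move=> {X}; apply: smallest_sub; last first.
  move=> H BH; have CH := sub_constructible BH; split=> //.
  apply: sub_gen_smallest; exists 1%g, 0%N, H; split=> //.
  by rewrite gen_usesu// ltranslate1 image_id.
split.
- move=> X Y [CX DX] [CY DY]; split; first exact: cU.
  have -> : e (X `|` Y) = (-1) *: (e X * e Y) + (e X + e Y).
    by rewrite gen_eU// gen_eI// scaleN1r [RHS]addrC addrK.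
  apply: (DL); first exact: DM.
  by rewrite -[e X]scale1r; exact: DL.
- by move=> X Y [CX DX] [CY DY]; split; [exact: cI|rewrite -gen_eI//; exact: DM].
- move=> X [CX DX]; split; first exact: cC.
  by rewrite gen_e_setC// addrC -scaleN1r; exact: DL.
- move=> X [CX DX]; split; first exact: cphi.
  by rewrite -[phi @` X]ltranslate1; exact: (Dact 1%g 1%N).
- move=> g X [CX DX]; split; first exact: cg.
  by rewrite -[X in ltranslate g X]image_id; exact: (Dact g 0%N).
Qed.

Definition isom_us (p : S) : U := u p.1 * s ^+ p.2.

Lemma gen_u1 : u 1%g = 1.
Proof.
apply: idempotent_isometry; first by case: (gen_u_unitary r 1%g).
by have := gen_usus r 1%g 1%g 0 0; rewrite /= !expr0 !mulr1 mulg1.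
Qed.

Lemma covariant_val : covariant (alpha r BT) (val : D -> U) isom_us.
Proof.
split=> //.
- move=> p; apply: isometryM; first by case: (gen_u_unitary r p.1).
  by apply: isometryX; exact: gen_s_isometry.
- by move=> p q; rewrite /isom_us mulrA gen_usus.
- by move=> p x; rewrite val_alpha_fun gen_uV /isom_us starM starX !mulrA.
Qed.

Section Covariant.
Variables (A : cstarAlgType R) (pi : D -> A) (rho : S -> A).
Hypothesis cov : covariant (alpha r BT) pi rho.

Let pi_hom : star_hom pi. Proof. by case: cov => -[]. Qed.
Let piM : {morph pi : x y / x * y}. Proof. by case: pi_hom. Qed.
Let piS : {morph pi : x / star x}. Proof. by case: pi_hom. Qed.
Let pi1 : pi 1 = 1. Proof. by case: cov => -[]. Qed.
Let rho_isometry p : star (rho p) * rho p = 1. Proof. by case: cov. Qed.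
Let rhoM p q : rho (p * q)%g = rho p * rho q. Proof. by case: cov. Qed.
Let rho_pi p x : rho p * pi x * star (rho p) = pi (act (alpha r BT) p x).
Proof. by case: cov. Qed.

(** pi is only defined on D, so e_X must be shown to lie there before pi can be
    applied; the value 0 is taken at sets X outside C(B) for which this
    fails. *)
Definition cov_e (X : set G) : A :=
  if pselect (csubalg_set (Dalg r BT) (e X)) is left Dx
  then pi (csubalg_in Dx) else 0.

Definition cov_u (g : G) : A := rho (g, 0%N).

Definition cov_s : A := rho (1%g, 1%N).

Lemma cov_eE X x : CB X -> val x = e X -> cov_e X = pi x.
Proof.
move=> CX xX; rewrite /cov_e; case: pselect => [DX|[]]; last exact: gen_e_in_D.
by congr pi; apply: val_inj.
Qed.

Let eD X (CX : CB X) : D := @csubalg_in R U (Dalg r BT) _ (gen_e_in_D CX).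

Let cov_e_eD X (CX : CB X) : cov_e X = pi (eD CX).
Proof. exact: cov_eE. Qed.

Let rho_one : rho (1%g, 0%N) = 1.
Proof.
apply: idempotent_isometry => //.
by rewrite -rhoM; congr rho; rewrite sdprodN_mulE/= mulg1.
Qed.

Let cov_uM g h : cov_u g * cov_u h = cov_u (g * h)%g.
Proof. by rewrite -rhoM. Qed.

Let cov_uV g : cov_u g^-1%g = star (cov_u g).
Proof.
apply: isometry_rinv; first exact: rho_isometry.
by rewrite cov_uM mulgV; exact: rho_one.
Qed.

Lemma cov_us g n : cov_u g * cov_s ^+ n = rho (g, n).
Proof.
have -> : cov_s ^+ n = rho (1%g, n).
  elim: n => [//|n IHn]; rewrite exprS IHn -rhoM.
  by congr rho; rewrite sdprodN_mulE/= phi1 mulg1.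
by rewrite -rhoM; congr rho; rewrite sdprodN_mulE/= mulg1.
Qed.

(** The relations between the projections hold in D and are transported by pi;
    those involving the unitaries and the isometry follow from
    rho(g, n) = rho(g, 0) rho(1, 1)^n and the covariance of the pair. *)
Lemma cov_Urep : exists r' : Urep phi B A,
  [/\ gen_e r' = cov_e, gen_u r' = cov_u & gen_s r' = cov_s].
Proof.
have [cU cI cC cphi cg] := constructible_closedP phi B.
unshelve eexists (@URep _ _ _ _ _ cov_e cov_u cov_s _ _ _ _ _ _ _ _ _) => //.
- move=> X CX; rewrite (cov_e_eD CX) -piS -piM; have [eS eM] := gen_e_proj r CX.
  by split; congr pi; apply: val_inj.
- move=> g; split; first exact: rho_isometry.
  by rewrite -cov_uV cov_uM mulgV; exact: rho_one.
- exact: rho_isometry.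
- by move=> g h n m; rewrite !cov_us -mulrA cov_us -rhoM.
- move=> g n X CX; rewrite cov_uV -mulrA -starX -starM cov_us (cov_e_eD CX) rho_pi.
  apply/esym/cov_eE; last by rewrite val_alpha_fun -gen_usesu.
  exact: constructible_us.
- rewrite -pi1; apply: cov_eE; first exact: sub_constructible.
  by rewrite gen_eT.
- rewrite -(star_hom0 pi_hom); apply: cov_eE; last by rewrite gen_e0.
  by rewrite -setCT; apply: cC; exact: sub_constructible.
- move=> X Y CX CY; rewrite (cov_e_eD CX) (cov_e_eD CY) -piM.
  by apply/esym/cov_eE; [exact: cI|exact: gen_eI].
- move=> X Y CX CY; rewrite (cov_e_eD CX) (cov_e_eD CY) (cov_e_eD (cU _ _ CX CY)).
  rewrite (cov_e_eD (cI _ _ CX CY)) -!(star_homD pi_hom); congr pi; apply: val_inj.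
  exact: gen_eU.
Qed.

End Covariant.

End CovariantRepresentations.

(** * The isomorphism *)

Theorem proposition3p1 (R : realType) (G : groupType)
  (G_countable : countable [set: G])
  (phi : {multiplicative G -> G})
  (phi_inj : injective phi)
  (phi_coker : infinite_cokernel phi)
  (B : set (set G))
  (B_subgroups : forall H, B H -> group_closed [in H])
  (BT : B [set: G])
  (U : cstarAlgType R) (r : Urep phi B U) (U_univ : is_universal r)
  (P : cstarAlgType R)
  (iotaD : csubalg_type (Dalg r BT) -> P) (iotaS : sdprodN phi -> P)
  (P_cp : is_crossed_product (alpha r BT) iotaD iotaS) :
  cstar_isomorphic U P.
Proof.
have [_ U_ex] := U_univ; have [cov _ P_ex] := P_cp.
have [r' [r'e r'u r's]] := cov_Urep cov.
have [f [[f_hom fe fu fs] _]] := U_ex P r'.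
have [g [[g_hom gD gS] _]] := P_ex _ _ _ (covariant_val BT r).
have f_unital : unital_star_hom f.
  split=> //; rewrite -(gen_eT r) fe ?gen_eT//; exact: sub_constructible.
(* Both sides are star homomorphisms on D, so the generating projections of D
   decide. *)
have f_val : f \o val =1 iotaD.
  apply: (@star_hom_eq_on_gens _ _ _ _ (D_gens r)) => //.
  - by apply: star_hom_comp.
  - by case: cov => -[].
  - move=> x [h [n [H [BH xE]]]].
    have CH : constructible phi B H by exact: sub_constructible.
    have CX : constructible phi B (ltranslate h (iter n phi @` H)).
      by apply: constructible_us; exact: CH.
    have {}xE := etrans xE (gen_usesu r h n CH).
    by rewrite /= xE fe// r'e; exact: cov_eE.
have f_us p : f (isom_us r p) = iotaS p.
  case: p => h n; rewrite /isom_us; have [_ fM _] := f_hom.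
  by rewrite fM unital_star_homX// fu fs r'u r's (cov_us cov).
exists f; split=> //; exists g.
- have [h [_ h_uniq]] := U_ex U r.
  suff gf : h = g \o f by move=> x; rewrite -[RHS]/(id x) -(h_uniq id)// gf.
  apply: h_uniq; split.
  + exact: star_hom_comp.
  + move=> X CX; pose x : csubalg_type (Dalg r BT) :=
      csubalg_in (gen_e_in_D BT CX : csubalg_set (Dalg r BT) _).
    by rewrite /= fe// r'e (cov_eE iotaD (x := x) CX)// gD.
  + by move=> h'; rewrite /= fu r'u /cov_u gS /isom_us GRing.expr0 GRing.mulr1.
  + by rewrite /= fs r's /cov_s gS /isom_us gen_u1 GRing.mul1r.
- have [h [_ h_uniq]] := P_ex _ _ _ cov.
  suff fg : h = f \o g by move=> x; rewrite -[RHS]/(id x) -(h_uniq id)// fg.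
  apply: h_uniq; split.
  + exact: star_hom_comp.
  + by move=> x; rewrite /= gD; exact: f_val.
  + by move=> p; rewrite /= gS f_us.
Qed.
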